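(* Let $Z=G(U)+\varepsilon$ satisfy conditions (1)--(5) listed in the context. Then for any $z\in\mathbb R^d$ the analysis variable $U^a=U+K(z-Z)$, $K=\mathrm{Cov}(U,Z)\,\mathrm{Cov}(Z)^{-1}$, coincides with $$U^a=\hat\phi_{\mathrm{LCM}}(z)+\left(U-\hat\phi_{\mathrm{LCM}}(Z)\right).$$ In particular, there holds $$\mathbb E[U^a]=\hat\phi_{\mathrm{LCM}}(z)\quad\text{and}\quad\mathrm{Cov}(U^a)=\mathrm{Cov}(U)-K\,\mathrm{Cov}(Z,U).$$
   Context: $\mathcal X$ is a separable Hilbert space with norm $\|\cdot\|$; $|\cdot|$ is the Euclidean norm on $\mathbb R^d$. $U$ is an $\mathcal X$-valued and $\varepsilon$ an $\mathbb R^d$-valued random variable on a probability space $(\Omega,\mathcal F,\mathbb P)$, $G:\mathcal X\to\mathbb R^d$, and $Z=G(U)+\varepsilon$. Conditions: (1) $U\sim\mu_0$, $\varepsilon\sim\nu_\varepsilon$ and $(U,\varepsilon)\sim\mu_0\otimes\nu_\varepsilon$ (independence). (2) $\nu_\varepsilon$ has Lebesgue density $\rho(\varepsilon)=c\,e^{-\ell(\varepsilon)}$ with $c>0$ and $\ell:\mathbb R^d\to[0,\infty)$ measurable. (3) $G$ is continuous. (4) With $\Phi(u;z):=\ell(z-G(u))$, there is a nondecreasing $\psi:[0,\infty)\to[0,\infty)$ with $\lim_{s\to0}\psi(s)=\psi(0)=0$ and $\int_{\mathcal X}|\Phi(u;z_1)-\Phi(u;z_2)|^2\,\mu_0(\mathrm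 du)\le\psi(|z_1-z_2|)$ for all $z_1,z_2\in\mathbb R^d$. (5) $\int_{\mathcal X}(\|u\|^2+|G(u)|^2)\,\mu_0(\mathrm du)<\infty$ and $\int_{\mathbb R^d}|\varepsilon|^2\,\nu_\varepsilon(\mathrm d\varepsilon)<\infty$. Linear posterior mean estimator: $$\hat\phi_{\mathrm{LCM}}=\operatorname*{argmin}_{\phi\in\mathcal P_1(\mathbb R^d;\mathcal X)}\mathbb E\left[\|U-\phi(Z)\|^2\right],$$ where $\mathcal P_1(\mathbb R^d;\mathcal X)=\{\phi:\phi(z)=b+Az,\ b\in\mathcal X,\ A:\mathbb R^d\to\mathcal X\text{ bounded linear}\}$. Covariance: for square-integrable Hilbert-space-valued random variables $X,Y$, $\mathrm{Cov}(X,Y)=\mathbb E[(X-\mathbb EX)\otimes(Y-\mathbb EY)]$, regarded as the linear operator $y\mapsto\mathbb E[\langle Y-\mathbb EY,y\rangle(X-\mathbb EX)]$ from the space of $Y$ to the space of $X$; $\mathrm{Cov}(X)=\mathrm{Cov}(X,X)$. In particular $\mathrm{Cov}(U,Z):\mathbb R^d\to\mathcal X$ and $\mathrm{Cov}(Z,U):\mathcal X\to\mathbb R^d$. *)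

(* Defs.v *)
From HB Require Import structures.
From mathcomp Require Import all_boot all_order all_algebra.
From mathcomp Require Import all_classical all_reals all_analysis.

Set Implicit Arguments.
Unset Strict Implicit.
Unset Printing Implicit Defensive.

Import Order.TTheory GRing.Theory Num.Theory.
Import numFieldNormedType.Exports.

Local Open Scope classical_set_scope.
Local Open Scope ring_scope.

Definition borel (T : ptopologicalType) := g_sigma_algebraType (@open T).

Definition separable (T : topologicalType) :=
  exists D : set T, countable D /\ dense D.

(* A Hilbert space is a complete normed module X with ip : {dot X for idfun}
   satisfying this compatibility with the norm of X. *)
Definition induces_norm (R : realType) (X : normedModType R)
    (ip : X -> X -> R) :=
  forall x, ip x x = `|x| ^+ 2.

(* R^d is 'rV[R]_d and |z| is enorm z.  The library norm of 'rV[R]_d is the sup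
   norm: it matters only for the topology, for Bochner integrals and for square
   integrability, which are the same for any equivalent norm. *)
Definition dotv (R : realType) (d : nat) (u v : 'rV[R]_d) : R :=
  \sum_i u ord0 i * v ord0 i.

Definition enorm (R : realType) (d : nat) (u : 'rV[R]_d) : R :=
  Num.sqrt (dotv u u).

(* Lebesgue measure on the Borel sets of R^d, as the iterated product
   of the one-dimensional one along R^(1+d) = R x R^d; R^0 is a point of mass 1. *)
Fixpoint lebesgue_rV (R : realType) (d : nat) :
    set (borel 'rV[R]_d) -> \bar R :=
  match d with
  | 0 => dirac (0 : borel 'rV[R]_0)
  | d'.+1 => pushforward (@lebesgue_measure R \x @lebesgue_rV R d')%E
      (fun p => row_mx (p.1%:M : 'rV[R]_1) p.2 : borel 'rV[R]_(d'.+1))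
  end.

Section Probability.
Context (R : realType) (disp : measure_display) (T : measurableType disp)
  (P : probability T R).

Definition has_law (d' : measure_display) (S : measurableType d')
    (X : T -> S) (mu : set S -> \bar R) :=
  forall A, measurable A -> P (X @^-1` A) = mu A.

Section Mean.
Context (X : normedModType R).

Definition random_vector (f : T -> X) :=
  measurable_fun [set: T] (f : T -> borel X).

Definition simple_vector (s : T -> X) :=
  random_vector s /\ finite_set (range s).

Definition simple_mean (s : T -> X) : X :=
  \sum_(x \in range s) fine (P (s @^-1` [set x])) *: x.

(* m is the Bochner integral of f with respect to P.  Borel measurability
   amounts to strong measurability when X is separable. *)
Definition has_mean (f : T -> X) (m : X) :=
  random_vector f /\
  exists s : nat -> T -> X,
    [/\ forall n, simple_vector (s n),
        (\int[P]_w (`|f w - s n w|)%:E)%E @[n --> \oo] --> 0%E &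
        simple_mean (s n) @[n --> \oo] --> m].

(* Equal to the default point when f has no Bochner integral. *)
Definition mean (f : T -> X) : X := get (has_mean f).

Definition square_integrable (f : T -> X) :=
  random_vector f /\ (\int[P]_w (`|f w| ^+ 2)%:E < +oo)%E.

End Mean.

(* Cov(X, Y) as an operator; ip is the inner product of the space of Y, which
   is a parameter because 'rV[R]_d carries the sup norm. *)
Definition Cov (V W : normedModType R) (ip : W -> W -> R)
    (X : T -> V) (Y : T -> W) : W -> V :=
  fun y => mean (fun w => ip (Y w - mean Y) y *: (X w - mean X)).

Section LinearEstimator.
Context (X : normedModType R) (d : nat).

Definition P1 (phi : 'rV[R]_d -> X) :=
  exists (b : X) (A : {linear 'rV[R]_d -> X}),
    (exists M : R, forall z, `|A z| <= M * enorm z) /\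
    forall z, phi z = b + A z.

Definition mse (U : T -> X) (Z : T -> 'rV[R]_d) (phi : 'rV[R]_d -> X) :=
  ('E_P[(fun w => `|U w - phi (Z w)| ^+ 2)%R])%E.

Definition is_LCM (U : T -> X) (Z : T -> 'rV[R]_d) (phi : 'rV[R]_d -> X) :=
  P1 phi /\ forall phi', P1 phi' -> (mse U Z phi <= mse U Z phi')%E.

(* Meaningful when the minimizer exists and is unique. *)
Definition LCM (U : T -> X) (Z : T -> 'rV[R]_d) : 'rV[R]_d -> X :=
  get (is_LCM U Z).

End LinearEstimator.

(* Cov(U, Z) Cov(Z)^-1, where pinv is the inverse as soon as Cov(Z) is
   bijective. *)
Definition gain (d : nat) (X : normedModType R) (U : T -> X)
    (Z : T -> 'rV[R]_d) : 'rV[R]_d -> X :=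
  Cov (@dotv R d) U Z \o pinv [set: 'rV[R]_d] (Cov (@dotv R d) Z Z).

End Probability.

(* Main.v *)
(** Everything is tested against the inner product: in a separable complete space the
    Bochner mean [m] of [f] is the only vector with [<m, x> = E <f, x>] for all [x].
    Write [U0], [Z0] for the centered variables.  [Cov Z] is injective, hence
    invertible: [E <Z0, y>^2 = 0] makes [<Z, y>] constant almost surely, while by
    independence the law of [<Z, y>] is an average of translates of that of
    [<eps, y>], which has no atom since hyperplanes are Lebesgue null.
    The gain [K] is the linear map with [K (Cov Z y) = Cov(U, Z) y], that is, the
    residual [W = U0 - K Z0] satisfies [E (<Z0, y> <W, x>) = 0].  Pythagoras then
    splits the mean square error of [z |-> v + A z] into
    [E |W|^2 + |E U - A (E Z) - v|^2 + E |(K - A) Z0|^2], so the unique minimizer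
    is [phi z = E U + K (z - E Z)].  The analysis variable is [phi z + W]; its mean
    is [phi z] and its covariance that of [W]. *)

Require Import Defs.
From HB Require Import structures.
From mathcomp Require Import all_boot all_order all_algebra.
From mathcomp Require Import all_classical all_reals all_analysis.
From mathcomp Require Import finmap measurable_realfun ring lra.

Set Implicit Arguments.
Unset Strict Implicit.
Unset Printing Implicit Defensive.

Import Order.TTheory GRing.Theory Num.Theory.
Import numFieldNormedType.Exports.

Local Open Scope classical_set_scope.
Local Open Scope ring_scope.

(** * Measurability in separable spaces *)

(** An index that codes no point of [D] is sent to the default point of [T]; extra values do no
    harm, since the sequence is only asked to meet every nonempty open set. *)
Lemma separable_dense_seq (T : ptopologicalType) : separable T ->
  exists e : nat -> T, forall O : set T, open O -> O !=set0 ->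
    exists n, O (e n).
Proof.
move=> [D [/countable_injP [f finj] dD]].
exists (fun n => get (fun x => D x /\ f x = n)) => O oO O0.
have [x [Ox Dx]] := dD O O0 oO; exists (f x).
have [De fe] : (fun y => D y /\ f y = f x) (get (fun y => D y /\ f y = f x)).
  exact: (@getPex _ (fun y => D y /\ f y = f x) (ex_intro _ x (conj Dx erefl))).
by rewrite (finj _ _ (mem_set De) (mem_set Dx) fe).
Qed.

Lemma separable_real (R : realType) : separable R^o.
Proof.
exists (range ratr); split; last exact: dense_rat.
by apply: sub_countable (card_image_le _ _) _; exact: countableP.
Qed.

Lemma separable_rV (R : realType) (d : nat) : separable 'rV[R]_d.
Proof.
exists (range (fun q : 'rV[rat]_d => map_mx ratr q : 'rV[R]_d)); split.
  by apply: sub_countable (card_image_le _ _) _; exact: countableP.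
move=> O [x Ox] oO.
have /nbhs_ballP [r r0 rO] : nbhs x O by exact: open_nbhs_nbhs.
(* A ball of the sup norm is a product of coordinate balls, so each coordinate is approximated
   separately. *)
have qP i : exists q : rat, ball (x ord0 i) r (ratr q : R).
  have [_ [/[swap] [[q _ <-]] xq]] := @dense_rat R (ball (x ord0 i) r)
    (ex_intro _ _ (ballxx _ r0)) (ball_open _ _).
  by exists q.
have [q qx] := choice qP.
exists (\row_i ratr (q i)); split; last first.
  by exists (\row_i q i) => //; apply/rowP => i; rewrite !mxE.
by apply: rO; split => // i j; rewrite mxE ord1; exact: qx.
Qed.

Section RandomVectors.
Context (R : realType) (disp : measure_display) (T : measurableType disp).

Lemma measurable_fun_borel (V : ptopologicalType) (f : T -> V) :
  (forall O : set V, open O -> measurable (f @^-1` O)) ->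
  measurable_fun [set: T] (f : T -> borel V).
Proof.
move=> fO; apply: (@measurability _ _ _ (borel V) _ _ (@open V)) => //.
by move=> _ [B oB <-]; rewrite setTI; exact: fO.
Qed.

Lemma borel_preimage_open (V : ptopologicalType) (f : T -> V) (O : set V) :
  measurable_fun [set: T] (f : T -> borel V) -> open O ->
  measurable (f @^-1` O).
Proof.
move=> mf oO; rewrite -[_ @^-1` _]setTI; apply: mf => //.
exact: sub_gen_smallest.
Qed.

(** By separability every open set of [V * W] is a countable union of products of balls centred on
    dense sequences, and the preimage of such a product is an intersection of two measurable
    sets. *)
Lemma measurable_fun_continuous2 (V W : normedModType R)
    (Y : ptopologicalType) (h : V * W -> Y) (f : T -> V) (g : T -> W) :
  separable V -> separable W -> continuous h ->
  random_vector f -> random_vector g ->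
  measurable_fun [set: T] ((fun w => h (f w, g w)) : T -> borel Y).
Proof.
move=> /separable_dense_seq [a da] /separable_dense_seq [b db] ch mf mg.
apply: measurable_fun_borel => O oO.
pose B (p : nat * nat * nat) := ball (a p.1.1) (p.2.+1%:R^-1 : R) `*`
  ball (b p.1.2) (p.2.+1%:R^-1 : R).
pose F p := [set w | B p (f w, g w) /\ (B p `<=` h @^-1` O)].
suff -> : (fun w => h (f w, g w)) @^-1` O = \bigcup_p F p.
  apply: countable_bigcupT_measurable => [|p]; first exact: countableP.
  (* This inclusion does not involve [w], so [F p] is either empty or the whole preimage of
     [B p]. *)
  have [BO|nBO] := pselect (B p `<=` h @^-1` O); last first.
    rewrite (_ : F p = set0); first exact: measurable0.
    by apply/seteqP; split=> // w [].
  rewrite (_ : F p = f @^-1` ball (a p.1.1) (p.2.+1%:R^-1 : R) `&`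
    g @^-1` ball (b p.1.2) (p.2.+1%:R^-1 : R)); last first.
    by apply/seteqP; split=> w [].
  by apply: measurableI; apply: borel_preimage_open => //; exact: ball_open.
apply/seteqP; split=> [w Ow|w [p _ [Bp pO]]]; last exact: (pO _ Bp).
have /nbhs_ballP [r r0 rO] : nbhs (f w, g w) (h @^-1` O).
  by apply: open_nbhs_nbhs; split => //; apply: open_comp => // ? _; exact: ch.
(* Radii below [r / 2] keep a product of balls that contains [(f w, g w)] inside the [r]-ball around
   that point. *)
have r20 : 0 < r / 2 by rewrite divr_gt0.
have [n nr] : exists n : nat, n.+1%:R^-1 < r / 2.
  have [n _ /(_ n (leqnn _)) nr] := near_infty_natSinv_lt (PosNum r20).
  by exists n.
have n0 : 0 < n.+1%:R^-1 :> R by rewrite invr_gt0.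
have [i fi] := da _ (ball_open (f w) (n.+1%:R^-1 : R)) (ex_intro _ _ (ballxx _ n0)).
have [j gj] := db _ (ball_open (g w) (n.+1%:R^-1 : R)) (ex_intro _ _ (ballxx _ n0)).
exists (i, j, n) => //; split; first by split; exact: ball_sym.
move=> [x y] [/= ax bY]; apply: rO; split => /=.
  by rewrite [r]splitr; apply: (@ball_triangle _ _ (a i));
    [exact: le_ball (ltW nr) _ fi|exact: le_ball (ltW nr) _ ax].
by rewrite [r]splitr; apply: (@ball_triangle _ _ (b j));
  [exact: le_ball (ltW nr) _ gj|exact: le_ball (ltW nr) _ bY].
Qed.

Lemma measurable_fun_continuous (V : normedModType R)
    (Y : ptopologicalType) (h : V -> Y) (f : T -> V) :
  continuous h -> random_vector f ->
  measurable_fun [set: T] ((h \o f) : T -> borel Y).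
Proof.
move=> ch mf; apply: measurable_fun_borel => O oO.
rewrite comp_preimage; apply: borel_preimage_open => //.
by apply: open_comp => // x _; exact: ch.
Qed.

(** Reconciles two generators of the Borel sets of the line: the open sets, behind [random_vector],
    and the intervals, behind real integration. *)
Lemma random_vector_real (f : T -> R^o) :
  random_vector f <-> measurable_fun [set: T] (f : T -> R).
Proof.
split=> [mf|mf].
  apply: (measurability _ (RGenOInfty.measurableE R)).
  move=> _ [_ [x ->] <-]; rewrite setTI; apply: borel_preimage_open => //.
apply: measurable_fun_borel => O oO; rewrite -[_ @^-1` _]setTI; apply: mf => //.
exact: open_measurable.
Qed.

End RandomVectors.

(** * Approximation by simple vectors *)

Section VectorIntegrals.
Context (R : realType) (disp : measure_display) (T : measurableType disp)
  (P : probability T R).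

Lemma random_vectorD (V : normedModType R) (f g : T -> V) : separable V ->
  random_vector f -> random_vector g -> random_vector (fun w => f w + g w).
Proof.
move=> sV mf mg.
apply: (@measurable_fun_continuous2 _ _ _ _ _ _ (fun p : V * V => p.1 + p.2)) => //.
exact: add_continuous.
Qed.

Lemma random_vectorB (V : normedModType R) (f g : T -> V) : separable V ->
  random_vector f -> random_vector g -> random_vector (fun w => f w - g w).
Proof.
move=> sV mf mg; apply: random_vectorD => //.
apply: (@measurable_fun_continuous _ _ _ _ _ (@GRing.opp V)) => //.
exact: opp_continuous.
Qed.

Lemma random_vectorZ (V : normedModType R) (a : T -> R) (f : T -> V) :
  separable V -> measurable_fun [set: T] a -> random_vector f ->
  random_vector (fun w => a w *: f w).
Proof.
move=> sV /(random_vector_real a).2 ma mf.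
apply: (@measurable_fun_continuous2 _ _ _ _ _ _ (fun p : R^o * V => p.1 *: p.2)) => //.
  exact: separable_real.
exact: scale_continuous.
Qed.

Lemma random_vector_cst (V : normedModType R) (v : V) :
  random_vector (fun _ : T => v).
Proof. exact: measurable_cst. Qed.

Lemma measurable_norm_rv (V : normedModType R) (f : T -> V) :
  random_vector f -> measurable_fun [set: T] (fun w => `|f w|).
Proof.
move=> mf; apply/(random_vector_real (fun w => `|f w|)).1.
apply: (@measurable_fun_continuous _ _ _ _ _ (fun x : V => `|x| : R^o)) => //.
exact: norm_continuous.
Qed.

Definition norm_integrable (V : normedModType R) (f : T -> V) :=
  random_vector f /\ P.-integrable [set: T] (EFin \o (fun w => `|f w|)).

(* A point of [0, e 0, ..., e (n-1)] closest to [f w]; starting from [0] makes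
   [|f|] dominate all the errors. *)
Fixpoint nearest (V : normedModType R) (e : nat -> V) (f : T -> V) (n : nat) :
    T -> V :=
  if n is n'.+1 then
    fun w => if `|f w - e n'| < `|f w - nearest e f n' w| then e n'
             else nearest e f n' w
  else fun=> 0.

Lemma nearest_le (V : normedModType R) (e : nat -> V) (f : T -> V) (n k : nat) w :
  (n <= k)%N -> `|f w - nearest e f k w| <= `|f w - nearest e f n w|.
Proof.
elim: k => [|k ih]; first by rewrite leqn0 => /eqP ->.
rewrite leq_eqVlt => /predU1P[->//|]; rewrite ltnS => /ih; apply: le_trans => /=.
by case: ifPn => // /ltW.
Qed.

Lemma nearest_simple (V : normedModType R) (e : nat -> V) (f : T -> V) (n : nat) :
  separable V -> random_vector f -> simple_vector (nearest e f n).
Proof.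
move=> sV mf; elim: n => [|n [mn fn]] /=.
  split; first exact: random_vector_cst.
  by apply: (@sub_finite_set _ _ [set 0]); [move=> _ [w _ <-]|exact: finite_set1].
split.
  apply: measurable_fun_ifT; [|exact: measurable_cst|exact: mn].
  apply: measurable_fun_ltr; apply: measurable_norm_rv; apply: random_vectorB => //.
  exact: random_vector_cst.
apply: (@sub_finite_set _ _ (e n |` range (nearest e f n))).
  by move=> _ [w _ <-]; case: ifP => _; [left|right; exists w].
by rewrite finite_setU; split => //; exact: finite_set1.
Qed.

Lemma nearest_cvg (V : normedModType R) (e : nat -> V) (f : T -> V) w :
  (forall B : set V, open B -> B !=set0 -> exists n, B (e n)) ->
  `|f w - nearest e f n w| @[n --> \oo] --> (0 : R).
Proof.
move=> de; apply/cvgrPdist_lt => r r0.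
have [n fn] := de _ (ball_open (f w) r) (ex_intro _ _ (ballxx _ r0)).
near=> k; rewrite sub0r normrN normr_id.
have nk : (n.+1 <= k)%N by near: k; exists n.+1.
apply: le_lt_trans (nearest_le e f w nk) _ => /=.
rewrite -ball_normE/= in fn.
by case: ifPn => //; rewrite -leNgt => /le_lt_trans; exact.
Unshelve. all: by end_near. Qed.

Lemma simple_approximation (V : normedModType R) (f : T -> V) :
  separable V -> norm_integrable f ->
  exists s : nat -> T -> V, (forall n, simple_vector (s n)) /\
    (\int[P]_w (`|f w - s n w|)%:E)%E @[n --> \oo] --> 0%E.
Proof.
move=> sV [mf If]; have [e de] := separable_dense_seq sV.
have sn n := nearest_simple e n sV mf.
exists (nearest e f); split=> //.
have md n : measurable_fun [set: T] (fun w => `|f w - nearest e f n w|).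
  by apply: measurable_norm_rv; apply: random_vectorB => //; case: (sn n).
have := @dominated_convergence _ T R P setT measurableT
  (fun n w => (`|f w - nearest e f n w|)%:E) (cst 0%E) (EFin \o (fun w => `|f w|)).
case.
- by move=> n; apply/measurable_EFinP; exact: md.
- exact: measurable_cst.
- by apply: aeW => w _; apply: cvg_EFin; [exact: nearW|exact: nearest_cvg].
- exact: If.
- apply: aeW => w n _ /=; rewrite lee_fin normr_id.
  by have := nearest_le e f w (leq0n n); rewrite /= subr0.
move=> _ _; rewrite integral0; exact.
Qed.

End VectorIntegrals.

(** * Bochner means *)

Section RealIntegrals.
Context (R : realType) (disp : measure_display) (T : measurableType disp)
  (P : probability T R).

Definition rintegrable (g : T -> R) := P.-integrable [set: T] (EFin \o g).

Lemma rintegrable_measurable (g : T -> R) :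
  rintegrable g -> measurable_fun [set: T] g.
Proof. by move=> /measurable_int /measurable_EFinP. Qed.

Lemma rintegrableD (f g : T -> R) : rintegrable f -> rintegrable g ->
  rintegrable (fun w => f w + g w).
Proof.
by move=> If Ig; exact: (integrableD measurableT If Ig).
Qed.

Lemma rintegrableZ (a : R) (g : T -> R) : rintegrable g ->
  rintegrable (fun w => a * g w).
Proof.
by move=> Ig; exact: (integrableZl measurableT a Ig).
Qed.

Lemma rintegrableB (f g : T -> R) : rintegrable f -> rintegrable g ->
  rintegrable (fun w => f w - g w).
Proof.
move=> If Ig; apply: rintegrableD => //.
have -> : (fun w => - g w) = (fun w => -1 * g w).
  by apply/funext => w; rewrite mulN1r.
exact: rintegrableZ.
Qed.

Lemma rintegrable_cst (a : R) : rintegrable (fun=> a).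
Proof. exact: finite_measure_integrable_cst. Qed.

Lemma rintegrable_le (f g : T -> R) : measurable_fun [set: T] g ->
  (forall w, `|g w| <= f w) -> rintegrable f -> rintegrable g.
Proof.
move=> mg gf If; apply: (le_integrable measurableT _ _ If).
  exact/measurable_EFinP.
move=> w _ /=; rewrite lee_fin; apply: le_trans (gf w) _; exact: ler_norm.
Qed.

Lemma rintegrable_indic (A : set T) : measurable A ->
  rintegrable (fun w => \1_A w).
Proof. by move=> mA; apply: integrable_indic => //; rewrite -ge0_fin_numE. Qed.

Lemma Rintegral_indic (A : set T) : measurable A ->
  \int[P]_w (\1_A w) = fine (P A).
Proof. by move=> mA; rewrite /Rintegral integral_indic// setIT. Qed.

Lemma Rintegral_probability_cst (a : R) : \int[P]_w a = a.
Proof.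
by rewrite Rintegral_cst// -[RHS]mulr1 -[1]/(fine 1%E) -(probability_setT P).
Qed.

Lemma rintegrable_sum (I : Type) (s : seq I) (g : I -> T -> R) :
  (forall i, rintegrable (g i)) -> rintegrable (fun w => \sum_(i <- s) g i w).
Proof.
move=> Ig; elim: s => [|i s ih].
  rewrite (_ : (fun _ => _) = (fun=> 0)); first exact: rintegrable_cst.
  by apply/funext => w; rewrite big_nil.
rewrite (_ : (fun _ => _) = (fun w => g i w + \sum_(j <- s) g j w)).
  exact: rintegrableD.
by apply/funext => w; rewrite big_cons.
Qed.

Lemma Rintegral_sum (I : Type) (s : seq I) (g : I -> T -> R) :
  (forall i, rintegrable (g i)) ->
  \int[P]_w (\sum_(i <- s) g i w) = \sum_(i <- s) \int[P]_w (g i w).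
Proof.
move=> Ig; elim: s => [|i s ih].
  rewrite big_nil; under eq_Rintegral do rewrite big_nil.
  by rewrite Rintegral_cst// mul0r.
rewrite big_cons -ih -RintegralD//; [|exact: Ig|exact: rintegrable_sum].
by apply: eq_Rintegral => w _; rewrite big_cons.
Qed.

End RealIntegrals.

(* The constant [M] is there for the Euclidean inner product, since 'rV[R]_d carries
   the sup norm. *)
Record form_spec (R : realType) (V : normedModType R) (b : V -> V -> R) (M : R)
    : Prop := FormSpec {
  form_bound_ge0 : 0 <= M;
  form_addl : forall x y z, b (x + y) z = b x z + b y z;
  form_scalel : forall a x z, b (a *: x) z = a * b x z;
  form_sym : forall x y, b x y = b y x;
  form_ub : forall x y, `|b x y| <= M * (`|x| * `|y|);
  form_lb : forall x, `|x| ^+ 2 <= b x x }.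

(** * Symmetric bilinear forms controlled from above and below by the norm *)

Section Forms.
Context (R : realType) (V : normedModType R) (b : V -> V -> R) (M : R)
  (bM : form_spec b M).

Lemma form_addr x y z : b x (y + z) = b x y + b x z.
Proof. by rewrite (form_sym bM) (form_addl bM) !(form_sym bM _ x). Qed.

Lemma form_scaler a x y : b x (a *: y) = a * b x y.
Proof. by rewrite (form_sym bM) (form_scalel bM) (form_sym bM y). Qed.

Lemma form_oppl x z : b (- x) z = - b x z.
Proof. by rewrite -scaleN1r (form_scalel bM) mulN1r. Qed.

Lemma form_oppr x z : b x (- z) = - b x z.
Proof. by rewrite -scaleN1r form_scaler mulN1r. Qed.

Lemma form_subl x y z : b (x - y) z = b x z - b y z.
Proof. by rewrite (form_addl bM) form_oppl. Qed.

Lemma form_subr x y z : b x (y - z) = b x y - b x z.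
Proof. by rewrite form_addr form_oppr. Qed.

Lemma form_0l z : b 0 z = 0.
Proof. by rewrite -(scale0r 0) (form_scalel bM) mul0r. Qed.

Lemma form_suml (I : Type) (s : seq I) (f : I -> V) z :
  b (\sum_(i <- s) f i) z = \sum_(i <- s) b (f i) z.
Proof.
elim: s => [|i s ih]; first by rewrite !big_nil form_0l.
by rewrite !big_cons (form_addl bM) ih.
Qed.

Lemma form_eq0 x : b x x = 0 -> x = 0.
Proof.
move=> bx0; apply/eqP; rewrite -normr_eq0 -sqrf_eq0 eq_le.
by rewrite exprn_ge0 ?andbT ?normr_ge0 -?bx0 ?(form_lb bM).
Qed.

(** Definiteness, applied to [x - y]. This reduces identities between Bochner means to identities
    between real integrals. *)
Lemma form_ext x y : (forall z, b x z = b y z) -> x = y.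
Proof.
move=> xy; apply/eqP; rewrite -subr_eq0; apply/eqP/form_eq0.
by rewrite form_subl xy subrr.
Qed.

Lemma form_continuous : continuous (fun p : V * V => b p.1 p.2 : R^o).
Proof.
move=> [x y]; apply/subr_cvg0/norm_cvg0P => /=.
apply: (@squeeze_cvgr _ _ _ _ (fun=> 0)
  (fun p : V * V => M * (`|p.1 - x| * `|p.2|) + M * (`|x| * `|p.2 - y|))).
- apply: nearW => p; rewrite normr_ge0/=.
  have -> : b p.1 p.2 - b x y = b (p.1 - x) p.2 + b x (p.2 - y).
    by rewrite form_subl form_subr addrA subrK.
  by apply: le_trans (ler_normD _ _) _; rewrite lerD//; exact: (form_ub bM).
- exact: cvg_cst.
have c1 : (fun p : V * V => `|p.1 - x| : R^o) @ nbhs (x, y) --> (0 : R).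
  rewrite -[X in _ --> X](@normr0 _ V) -(subrr x).
  apply: cvg_norm; apply: cvgB; [exact: cvg_fst|exact: cvg_cst].
have c2 : (fun p : V * V => `|p.2 - y| : R^o) @ nbhs (x, y) --> (0 : R).
  rewrite -[X in _ --> X](@normr0 _ V) -(subrr y).
  apply: cvg_norm; apply: cvgB; [exact: cvg_snd|exact: cvg_cst].
have c3 : (fun p : V * V => `|p.2| : R^o) @ nbhs (x, y) --> `|y|.
  by apply: cvg_norm; exact: cvg_snd.
have -> : 0 = M * (0 * `|y|) + M * (`|x| * 0) by rewrite mul0r !mulr0 addr0.
apply: cvgD; apply: cvgM; try exact: cvg_cst; apply: cvgM => //; exact: cvg_cst.
Qed.

Lemma form_continuousl z : continuous (fun x => b x z : R^o).
Proof.
move=> x; apply: (@cvg_comp _ _ _ (fun x => (x, z)) (fun p : V * V => b p.1 p.2)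
  _ (nbhs (x, z))); last exact: (@form_continuous (x, z)).
by apply: cvg_pair; [exact: cvg_id|exact: cvg_cst].
Qed.

End Forms.

(** * Existence and weak characterization of Bochner means *)

Section Means.
Context (R : realType) (disp : measure_display) (T : measurableType disp)
  (P : probability T R).
Context (V : normedModType R) (b : V -> V -> R) (M : R) (bM : form_spec b M)
  (sV : separable V).
Implicit Types f g s : T -> V.

Lemma measurable_form f g : random_vector f -> random_vector g ->
  measurable_fun [set: T] (fun w => b (f w) (g w)).
Proof.
move=> mf mg; apply/(random_vector_real (fun w => b (f w) (g w))).1.
apply: (@measurable_fun_continuous2 _ _ _ _ _ _
  (fun p : V * V => b p.1 p.2 : R^o)) => //.
exact: (form_continuous bM).
Qed.

Lemma form_rintegrable f y : norm_integrable P f ->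
  rintegrable P (fun w => b (f w) y).
Proof.
move=> [mf If]; apply: (@rintegrable_le _ _ _ _ (fun w => (M * `|y|) * `|f w|)).
- by apply: measurable_form => //; exact: measurable_cst.
- by move=> w; apply: le_trans (form_ub bM _ _) _; rewrite -mulrA (mulrC `|y|).
- exact: rintegrableZ.
Qed.

Lemma norm_integrableB f g : norm_integrable P f -> norm_integrable P g ->
  norm_integrable P (fun w => f w - g w).
Proof.
move=> [mf If] [mg Ig]; have mfg := random_vectorB sV mf mg; split => //.
apply: (@rintegrable_le _ _ _ _ (fun w => `|f w| + `|g w|)).
- exact: measurable_norm_rv.
- by move=> w; rewrite normr_id; exact: ler_normB.
- exact: rintegrableD.
Qed.

Lemma simple_preimage (s : T -> V) (x : V) : simple_vector s ->
  measurable (s @^-1` [set x]).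
Proof.
move=> [ms _]; rewrite -[X in measurable X]setCK preimage_setC.
apply: measurableC; apply: borel_preimage_open => //.
by rewrite openC; apply: accessible_closed_set1; exact: hausdorff_accessible.
Qed.

(** [F] is arbitrary because the expansion over level sets serves twice: with the norm for
    integrability, with [b x y] for the mean. *)
Lemma simple_sumE (F : V -> R) (s : T -> V) (w : T) : simple_vector s ->
  F (s w) = \sum_(x <- fset_set (range s)) F x * \1_(s @^-1` [set x]) w.
Proof.
move=> [_ fs]; have sw : s w \in fset_set (range s).
  by rewrite in_fset_set//; apply/mem_set; exists w.
rewrite (big_fsetD1 (s w))//= big1_fset => [|x]; last first.
  rewrite !inE => /andP[xs _] _.
  by rewrite indicE memNset ?mulr0// => /= swx; rewrite swx eqxx in xs.
by rewrite addr0 indicE mem_set// mulr1.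
Qed.

Lemma simple_norm_integrable (s : T -> V) : simple_vector s ->
  norm_integrable P s.
Proof.
move=> ss; split; first by case: ss.
rewrite (_ : (fun w => `|s w|) = (fun w =>
    \sum_(x <- fset_set (range s)) `|x| * \1_(s @^-1` [set x]) w)).
  apply: rintegrable_sum => x; apply: rintegrableZ; apply: rintegrable_indic.
  exact: simple_preimage.
by apply/funext => w; exact: (simple_sumE (fun x => `|x|)).
Qed.

Lemma form_simple_mean (s : T -> V) (y : V) : simple_vector s ->
  b (simple_mean P s) y = \int[P]_w b (s w) y.
Proof.
move=> ss; have [_ fs] := ss.
rewrite /simple_mean fsbig_finite//= (form_suml bM).
under [RHS]eq_Rintegral do rewrite (simple_sumE (fun x => b x y))//.
rewrite Rintegral_sum => [|x].
  apply: eq_bigr => x _; rewrite (form_scalel bM) mulrC RintegralZl//.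
    by rewrite Rintegral_indic//; exact: simple_preimage.
  by apply: rintegrable_indic; exact: simple_preimage.
by apply: rintegrableZ; apply: rintegrable_indic; exact: simple_preimage.
Qed.

Lemma Rintegral_form_le f y : norm_integrable P f ->
  `|\int[P]_w b (f w) y| <= M * `|y| * \int[P]_w `|f w|.
Proof.
move=> If; have Ify := form_rintegrable y If.
apply: le_trans (le_normr_Rintegral measurableT Ify) _.
have bIf : rintegrable P (fun w => M * `|y| * `|f w|).
  by apply: rintegrableZ; case: If.
have fy w : `|b (f w) y| <= M * `|y| * `|f w|.
  by apply: le_trans (form_ub bM _ _) _; rewrite -mulrA (mulrC `|y|).
rewrite -RintegralZl//; last by case: If.
apply: le_Rintegral => //; apply: rintegrable_le bIf.
  apply: (measurableT_comp (@normr_measurable R setT)).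
  exact: rintegrable_measurable Ify.
by move=> w; rewrite normr_id.
Qed.

Lemma cvg_norm_Rintegral f (s : nat -> T -> V) : norm_integrable P f ->
  (forall n, simple_vector (s n)) ->
  (\int[P]_w (`|f w - s n w|)%:E)%E @[n --> \oo] --> 0%E ->
  \int[P]_w `|f w - s n w| @[n --> \oo] --> (0 : R).
Proof.
move=> If ss /fine_cvgP[_]; exact.
Qed.

(** True for simple vectors by linearity. Along the approximating sequence the left side converges
    by continuity of the form, and the right side because the errors are at most [M * |y|] times the
    L1 distance. *)
Lemma form_has_mean f m y : norm_integrable P f -> has_mean P f m ->
  b m y = \int[P]_w b (f w) y.
Proof.
move=> If [_ [s [ss /(cvg_norm_Rintegral If ss) fs sm]]].
have bsm : b (simple_mean P (s n)) y @[n --> \oo] --> b m y.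
  exact: (cvg_comp _ _ sm (form_continuousl bM (z := y) (x := m))).
apply: (cvg_unique _ bsm); first exact: Rhausdorff.
apply/subr_cvg0/norm_cvg0P.
apply: (@squeeze_cvgr _ _ _ _ (fun=> 0)
  (fun n => M * `|y| * \int[P]_w `|f w - s n w|)).
- apply: nearW => n; rewrite normr_ge0/= form_simple_mean//.
  have Is := simple_norm_integrable (ss n).
  rewrite distrC -RintegralB//; [|exact: form_rintegrable..].
  apply: le_trans (Rintegral_form_le y (norm_integrableB If Is)).
  by rewrite le_eqVlt; apply/orP; left; apply/eqP; congr (`|_|);
     apply: eq_Rintegral => w _; rewrite (form_subl bM).
- exact: cvg_cst.
- rewrite -(mulr0 (M * `|y|)); apply: cvgM => //; exact: cvg_cst.
Qed.

(** Pairing the difference [z] of the means with itself gives |z|^2 <= b z z = E b(s - t, z) <= M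
    |z| E|s - t|; then divide by |z|. *)
Lemma simple_mean_dist (s t : T -> V) : simple_vector s -> simple_vector t ->
  `|simple_mean P s - simple_mean P t| <= M * \int[P]_w `|s w - t w|.
Proof.
move=> ss st; set z := _ - _.
have [Is It] := (simple_norm_integrable ss, simple_norm_integrable st).
have [->|z0] := eqVneq z 0.
  by rewrite normr0 mulr_ge0 ?(form_bound_ge0 bM)// Rintegral_ge0.
rewrite -(@ler_pM2r _ `|z|) ?normr_gt0// -expr2.
apply: le_trans (form_lb bM z) _; rewrite {1}/z (form_subl bM).
rewrite !form_simple_mean// -RintegralB//; [|exact: form_rintegrable..].
apply: le_trans (ler_norm _) _; rewrite mulrAC.
apply: le_trans (Rintegral_form_le z (norm_integrableB Is It)).
rewrite le_eqVlt; apply/orP; left; apply/eqP; congr (`|_|).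
by apply: eq_Rintegral => w _; rewrite (form_subl bM).
Qed.

Hypothesis complete : forall u : nat -> V, cauchy (u n @[n --> \oo]) ->
  cvg (u n @[n --> \oo]).

(** By [simple_mean_dist] and the triangle inequality through [f], the means of simple
    approximations form a Cauchy sequence, which completeness makes converge. *)
Lemma mean_exists f : norm_integrable P f -> exists m, has_mean P f m.
Proof.
move=> If; have [s [ss fs]] := simple_approximation sV If.
have fs' := cvg_norm_Rintegral If ss fs.
pose u n := simple_mean P (s n); pose e n := \int[P]_w `|f w - s n w|.
have Is n := simple_norm_integrable (ss n).
have ubound n k : `|u n - u k| <= M * (e n + e k).
  apply: le_trans (simple_mean_dist (ss n) (ss k)) _.
  apply: ler_wpM2l; first exact: (form_bound_ge0 bM).
  have [Ifn Ifk] := (norm_integrableB If (Is n), norm_integrableB If (Is k)).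
  rewrite /e -RintegralD//; [|by case: Ifn|by case: Ifk].
  apply: le_Rintegral => //.
  - by case: (norm_integrableB (Is n) (Is k)).
  - by apply: rintegrableD; [case: Ifn|case: Ifk].
  - by move=> w _; rewrite (distrC (f w)); exact: ler_distD.
have /cvg_ex[m um] : cvg (u n @[n --> \oo]).
  apply: complete; apply: cauchy_exP => r r0.
  have Me : M * e n @[n --> \oo] --> (0 : R).
    by rewrite -(mulr0 M); apply: cvgM => //; exact: cvg_cst.
  have [N _ NMe] : \forall n \near \oo, `|0 - M * e n| < r / 2.
    by move/cvgrPdist_lt : Me; apply; rewrite divr_gt0.
  have {}NMe n : (N <= n)%N -> M * e n < r / 2.
    by move=> /NMe /=; rewrite sub0r normrN; apply: le_lt_trans; exact: ler_norm.
  exists (u N), N => // n /= Nn; rewrite -ball_normE /=.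
  by rewrite (le_lt_trans (ubound _ _))// mulrDr [r]splitr ltrD// NMe.
exists m; split; first by case: If.
by exists s; split.
Qed.

Lemma mean_has_mean f : norm_integrable P f -> has_mean P f (mean P f).
Proof. by move=> If; exact: (getPex (mean_exists If)). Qed.

Lemma form_mean f y : norm_integrable P f ->
  b (mean P f) y = \int[P]_w b (f w) y.
Proof. by move=> If; apply: form_has_mean => //; exact: mean_has_mean. Qed.

End Means.

(** * Hyperplanes are Lebesgue null *)

Import HBNNSimple.

(* [mu] is any set function, as [lebesgue_rV] is not shown to be a measure. *)
Lemma integral_null_set (d : measure_display) (T : measurableType d)
    (R : realType) (mu : set T -> \bar R) (A : set T) (f : T -> \bar R) :
  (forall B, B `<=` A -> mu B = 0%E) -> (\int[mu]_(x in A) f x)%E = 0%E.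
Proof.
move=> muA.
(* A simple function below [g] vanishes off [A] where it is positive in value, so its nonzero levels
   lie in [A] and weigh nothing: the supremum defining the integral is over zeros only. The positive
   and negative parts of [f] restricted to [A] both have this shape. *)
have sup0 (g : T -> \bar R) : (forall x, 0 <= g x)%E ->
    (forall x, ~ A x -> g x = 0%E) ->
    ereal_sup [set sintegral mu h | h in
      [set h : {nnsfun T >-> R} | forall x, ((h x)%:E <= g x)%E]] = 0%E.
  move=> g0 gA; set S := (X in ereal_sup X).
  suff -> : S = [set 0%E] by rewrite ereal_sup1.
  have h0 (h : {nnsfun T >-> R}) : (forall x, (h x)%:E <= g x)%E ->
      sintegral mu h = 0%E.
    move=> hg; rewrite /sintegral fsbig1// => r _.
    have [->|r0] := eqVneq r 0; first by rewrite mul0e.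
    rewrite muA ?mule0// => x /= hr; apply: contrapT => /gA gx.
    move: r0; rewrite -hr => /negP; apply; rewrite eq_le -lee_fin -[0%:E]gx hg.
    exact: fun_ge0.
  apply/seteqP; split=> [_ [h hg <-]|_ ->] /=; first exact: h0.
  by exists nnsfun0 => [x /=|]; [exact: g0|apply: h0 => x; exact: g0].
by rewrite /integral !sup0 ?sube0// => x;
  rewrite ?funeposE ?funenegE ?le_max ?lexx ?orbT//;
  rewrite patchE; case: ifPn => [/set_mem//|_ _]; rewrite ?oppe0 maxxx.
Qed.

Lemma lebesgue_rV_set0 (R : realType) (d : nat) : @lebesgue_rV R d set0 = 0%E.
Proof.
elim: d => [|d ih] /=; first exact: measure0.
rewrite /pushforward preimage_set0 /product_measure1 integral0_eq// => x _.
by rewrite /= xsection0.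
Qed.

(** Induction that splits off the first coordinate. If the tail [y'] is nonzero, each section lies
    in a hyperplane of one dimension less; otherwise the set lies over the single point [a / t]. All
    subsets [B] are covered, measurable or not, as [integral_null_set] asks. *)
Lemma lebesgue_rV_hyperplane (R : realType) (d : nat) (y : 'rV[R]_d) (a : R)
    (B : set (borel 'rV[R]_d)) :
  y != 0 -> B `<=` [set x | dotv x y = a] -> lebesgue_rV B = 0%E.
Proof.
elim: d y a B => [|d ih] y a B y0 By.
  by move: y0; rewrite (_ : y = 0) ?eqxx//; apply/rowP; case.
rewrite /= /pushforward /product_measure1.
pose t : R := y 0 0; pose y' : 'rV[R]_d := \row_i y 0 (lift ord0 i).
have dotE (p : R) (q : 'rV[R]_d) :
    dotv (row_mx (p%:M : 'rV[R]_1) q : 'rV[R]_d.+1) y = p * t + dotv q y'.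
  rewrite /dotv big_ord_recl; congr (_ * _ + _).
    have -> : ord0 = lshift d (ord0 : 'I_1) by apply: val_inj.
    by rewrite (@row_mxEl R 1 1 d) mxE eqxx mulr1n.
  apply: eq_bigr => i _; rewrite [in RHS]mxE; congr (_ * _).
  have -> : lift ord0 i = rshift 1 i by apply: val_inj.
  by rewrite (@row_mxEr R 1 1 d).
set C := _ @^-1` B.
have [y'0|y'0] := eqVneq y' 0; last first.
  apply: integral0_eq => x _; apply: (ih y' (a - x * t)) => // v.
  move=> /set_mem /By /=; rewrite dotE => <-.
  by rewrite addrC addKr.
have t0 : t != 0.
  apply: contra_neq y0 => t0; apply/rowP => i; rewrite mxE.
  case: (unliftP ord0 i) => [j ->|->] //.
  by have /rowP/(_ j) := y'0; rewrite !mxE.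
have xs0 x : x != a / t -> xsection C x = set0.
  move=> xa; apply/seteqP; split => // v; move=> /set_mem /By /=.
  rewrite dotE y'0 => H; move/eqP: xa; apply; rewrite -H /dotv.
  by rewrite big1 ?addr0 ?mulfK// => i _; rewrite mxE mulr0.
(* All sections but the one at [a / t] are empty, so the integral reduces to one over a single
   point. *)
rewrite -(@integral_set1 R (fun x => lebesgue_rV (xsection C x)) (a / t)).
rewrite [RHS]integral_mkcond; apply: eq_integral => x _ /=.
rewrite patchE; case: ifPn => //; rewrite notin_setE /= => /eqP /xs0 ->.
exact: lebesgue_rV_set0.
Qed.

(** * The inner products of a Hilbert space and of R^d *)

Lemma ip_form_spec (R : realType) (X : normedModType R) (ip : {dot X for idfun}) :
  induces_norm ip -> form_spec ip 1.
Proof.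
move=> ipn.
have ipC x y : ip x y = ip y x by rewrite (hermC ip) expr0 mul1r.
have ipD x y z : ip (x + y) z = ip x z + ip y z by rewrite linearDl.
have ipZ a x z : ip (a *: x) z = a * ip x z by rewrite linearZl_LR.
have ip_ub x y : ip x y <= `|x| * `|y|.
  (* Cauchy-Schwarz from the triangle inequality for the norm *)
  have : ip (x + y) (x + y) <= (`|x| + `|y|) ^+ 2.
    by rewrite ipn lerXn2r ?nnegrE ?addr_ge0// ler_normD.
  rewrite ipD !(ipC _ (x + y)) !ipD !ipn (ipC y x) sqrrD.
  by lra.
split=> //.
- move=> x y; rewrite mul1r ler_norml ip_ub andbT.
  by rewrite lerNl -mulN1r -ipZ scaleN1r -(normrN x) ip_ub.
- by move=> x; rewrite ipn.
Qed.

Section EuclideanSpace.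
Context (R : realType) (d : nat).
Implicit Types u v z : 'rV[R]_d.

Lemma norm_coord_le u i : `|u 0 i| <= `|u|.
Proof.
by rewrite [leRHS]mx_normrE; exact: (le_bigmax _ (fun ij => `|u ij.1 ij.2|) (0, i)).
Qed.

Lemma dotvC u v : dotv u v = dotv v u.
Proof. by apply: eq_bigr => i _; rewrite mulrC. Qed.

Lemma dotv_ge0 u : 0 <= dotv u u.
Proof. by apply: sumr_ge0 => i _; rewrite -expr2 sqr_ge0. Qed.

Lemma sqr_enorm u : enorm u ^+ 2 = dotv u u.
Proof. by rewrite sqr_sqrtr// dotv_ge0. Qed.

Lemma sqr_norm_le_dotv u : `|u| ^+ 2 <= dotv u u.
Proof.
have [->|u0] := eqVneq (`|u|) 0; first by rewrite expr0n dotv_ge0.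
have [[i j] /= uij] := mx_norm_neq0 u0.
have {}uij : `|u| = `|u i j| := uij.
rewrite uij ord1 real_normK ?num_real// /dotv (bigD1 j)//= -expr2 lerDl.
by apply: sumr_ge0 => k _; rewrite -expr2 sqr_ge0.
Qed.

Lemma norm_le_enorm u : `|u| <= enorm u.
Proof.
rewrite -(@ler_pXn2r _ 2) ?nnegrE ?sqrtr_ge0//.
by rewrite sqr_enorm sqr_norm_le_dotv.
Qed.

(** The constant counts the coordinates: each of the [d] products is at most |x| |y| in the sup
    norm. *)
Lemma dotv_form_spec : form_spec (@dotv R d) d%:R.
Proof.
split.
- exact: ler0n.
- move=> x y z; rewrite /dotv -big_split; apply: eq_bigr => i _.
  by rewrite mxE mulrDl.
- move=> a x z; rewrite /dotv mulr_sumr; apply: eq_bigr => i _.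
  by rewrite mxE mulrA.
- exact: dotvC.
- move=> x y; apply: le_trans (ler_norm_sum _ _ _) _.
  have -> : d%:R * (`|x| * `|y|) = \sum_(i < d) `|x| * `|y|.
    by rewrite sumr_const card_ord mulr_natl.
  apply: ler_sum => i _.
  by rewrite normrM ler_pM// norm_coord_le.
- exact: sqr_norm_le_dotv.
Qed.

Lemma dotv_delta u i : dotv u (delta_mx 0 i) = u 0 i.
Proof.
rewrite /dotv (bigD1 i)//= mxE !eqxx mulr1 big1 ?addr0// => j ji.
by rewrite mxE eqxx (negbTE ji) mulr0.
Qed.

Section LinearMaps.
Context (X : normedModType R).

Lemma linear_rV_sum (A : {linear 'rV[R]_d -> X}) z :
  A z = \sum_i z 0 i *: A (delta_mx 0 i).
Proof.
by rewrite {1}[z]row_sum_delta linear_sum; apply: eq_bigr => i _; rewrite linearZ.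
Qed.

Lemma linear_rV_bound (A : {linear 'rV[R]_d -> X}) :
  {M : R | 0 <= M & forall z, `|A z| <= M * `|z|}.
Proof.
exists (\sum_i `|A (delta_mx 0 i)|); first exact: sumr_ge0.
move=> z; rewrite linear_rV_sum mulr_suml.
apply: le_trans (ler_norm_sum _ _ _) _; apply: ler_sum => i _.
by rewrite normrZ mulrC ler_wpM2l// norm_coord_le.
Qed.

Lemma linear_rV_continuous (A : {linear 'rV[R]_d -> X}) : continuous A.
Proof.
have [M M0 AM] := linear_rV_bound A.
apply/linear_bounded_continuous/linear_boundedP.
near=> r => x; apply: le_trans (AM x) _; apply: ler_wpM2r; first exact: normr_ge0.
by near: r; apply: nbhs_pinfty_ge; exact: num_real.
Unshelve. all: by end_near. Qed.

End LinearMaps.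

End EuclideanSpace.

(** * Square integrable random vectors *)

Section SquareIntegrable.
Context (R : realType) (disp : measure_display) (T : measurableType disp)
  (P : probability T R).
Implicit Types a b : T -> R.

(** Measurability of [a] is a separate clause because that of its square leaves the sign free. *)
Definition L2 a := measurable_fun [set: T] a /\ rintegrable P (fun w => a w ^+ 2).

Lemma L2_mul a b : L2 a -> L2 b -> rintegrable P (fun w => a w * b w).
Proof.
move=> [ma Ia] [mb Ib]; apply: rintegrable_le (rintegrableD Ia Ib).
  exact: measurable_funM.
by move=> w; rewrite ler_norml; nra.
Qed.

Lemma L2_cst (k : R) : L2 (fun=> k).
Proof. by split; [exact: measurable_cst|exact: rintegrable_cst]. Qed.

Lemma L2_rintegrable a : L2 a -> rintegrable P a.
Proof.
move=> /L2_mul/(_ (L2_cst 1)).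
by congr rintegrable; apply/funext => w; rewrite mulr1.
Qed.

Lemma L2_le a b : measurable_fun [set: T] a -> (forall w, `|a w| <= `|b w|) ->
  L2 b -> L2 a.
Proof.
move=> ma ab [mb Ib]; split=> //; apply: rintegrable_le Ib.
  exact: measurable_funX.
move=> w; rewrite ger0_norm ?sqr_ge0//.
by rewrite -[leLHS]real_normK ?num_real// -[leRHS]real_normK ?num_real// lerXn2r.
Qed.

Lemma L2Z (k : R) a : L2 a -> L2 (fun w => k * a w).
Proof.
move=> [ma Ia]; split; first by apply: measurable_funM.
by rewrite (_ : (fun _ => _) = (fun w => k ^+ 2 * a w ^+ 2));
  [exact: rintegrableZ|apply/funext => w; rewrite exprMn].
Qed.

Lemma L2D a b : L2 a -> L2 b -> L2 (fun w => a w + b w).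
Proof.
move=> La Lb; have [[ma Ia] [mb Ib]] := (La, Lb); split.
  exact: measurable_funD.
rewrite (_ : (fun _ => _) = (fun w => (a w ^+ 2 + b w ^+ 2) + 2 * (a w * b w))).
  by apply: rintegrableD; [exact: rintegrableD|apply/rintegrableZ/L2_mul].
by apply/funext => w; ring.
Qed.

Lemma square_integrable_L2 (V : normedModType R) (f : T -> V) :
  square_integrable P f <-> random_vector f /\ L2 (fun w => `|f w|).
Proof.
split=> [[mf fi]|[mf [_ fi]]]; split => //.
  have mn := measurable_norm_rv mf; split=> //; apply/integrableP; split.
    by apply/measurable_EFinP; exact: measurable_funX.
  rewrite (eq_integral (fun w => (`|f w| ^+ 2)%:E))// => w _.
  by rewrite gee0_abs// lee_fin sqr_ge0.
move/integrableP : fi => [_]; rewrite (eq_integral (fun w => (`|f w| ^+ 2)%:E))//.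
by move=> w _; rewrite gee0_abs// lee_fin sqr_ge0.
Qed.

Section Vectors.
Context (V : normedModType R) (c : V -> V -> R) (M : R) (cM : form_spec c M)
  (sV : separable V).
Implicit Types f g : T -> V.

Lemma square_integrableD f g : square_integrable P f -> square_integrable P g ->
  square_integrable P (fun w => f w + g w).
Proof.
move=> /square_integrable_L2[mf Lf] /square_integrable_L2[mg Lg].
have mfg := random_vectorD sV mf mg.
apply/square_integrable_L2; split=> //; apply: L2_le (L2D Lf Lg).
  exact: measurable_norm_rv.
by move=> w; rewrite normr_id ger0_norm ?addr_ge0// ler_normD.
Qed.

Lemma square_integrable_cst (v : V) : square_integrable P (fun=> v).
Proof.
apply/square_integrable_L2; split; first exact: measurable_cst.
exact: L2_cst.
Qed.

Lemma square_integrableB f g : square_integrable P f -> square_integrable P g ->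
  square_integrable P (fun w => f w - g w).
Proof.
move=> Sf /square_integrable_L2[mg Lg]; apply: square_integrableD => //.
apply/square_integrable_L2; split; last first.
  by move: Lg; congr L2; apply/funext => w; rewrite normrN.
apply: (@measurable_fun_continuous _ _ _ _ _ (@GRing.opp V)) => //.
exact: opp_continuous.
Qed.

Lemma square_integrable_norm_integrable f : square_integrable P f ->
  norm_integrable P f.
Proof. by move=> /square_integrable_L2[mf /L2_rintegrable If]. Qed.

(** Gives the Bochner integrability of the integrand that defines [Cov]. *)
Lemma L2_scale_norm_integrable a f : L2 a -> square_integrable P f ->
  norm_integrable P (fun w => a w *: f w).
Proof.
move=> La /square_integrable_L2[mf Lf]; have [ma _] := La.
have maf := random_vectorZ sV ma mf; split=> //.
have La' : L2 (fun w => `|a w|).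
  by apply: L2_le La => [|w]; [exact: measurableT_comp|rewrite normr_id].
by move: (L2_mul La' Lf); congr rintegrable; apply/funext => w; rewrite normrZ.
Qed.

Lemma L2_form f y : square_integrable P f -> L2 (fun w => c (f w) y).
Proof.
move=> /square_integrable_L2[mf Lf]; apply: L2_le (L2Z (M * `|y|) Lf).
  by apply: (measurable_form cM) => //; exact: measurable_cst.
move=> w; apply: le_trans (form_ub cM _ _) _.
rewrite (mulrC `|f w|) mulrA; exact: ler_norm.
Qed.

Lemma rintegrable_form f g : square_integrable P f -> square_integrable P g ->
  rintegrable P (fun w => c (f w) (g w)).
Proof.
move=> /square_integrable_L2[mf Lf] /square_integrable_L2[mg Lg].
apply: rintegrable_le (rintegrableZ M (L2_mul Lf Lg)).
  exact: (measurable_form cM).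
by move=> w; exact: form_ub.
Qed.

End Vectors.

Lemma square_integrable_linear (d : nat) (X : normedModType R)
    (A : {linear 'rV[R]_d -> X}) (Z : T -> 'rV[R]_d) :
  square_integrable P Z -> square_integrable P (fun w => A (Z w)).
Proof.
move=> /square_integrable_L2[mZ LZ]; have [M M0 AM] := linear_rV_bound A.
have mAZ : random_vector (fun w => A (Z w)).
  by apply: (measurable_fun_continuous (h := A)) => //; exact: linear_rV_continuous.
apply/square_integrable_L2; split=> //; apply: L2_le (L2Z M LZ).
  exact: measurable_norm_rv.
by move=> w; rewrite normr_id (le_trans (AM _))// ler_norm.
Qed.

End SquareIntegrable.

(** * Covariance and linear regression *)

(** Bundles a proof of linearity into a linear map, the form in which the results on maps out of
    ['rV[R]_d] take their argument. *)
Lemma linear_ex (R : nzRingType) (U V : lmodType R) (f : U -> V) :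
  linear f -> exists A : {linear U -> V}, A =1 f.
Proof.
move=> fl; pose m := GRing.isLinear.Build R U V *:%R f fl.
by pose A : {linear U -> V} := HB.pack f m; exists A.
Qed.

Section Covariance.
Context (R : realType) (disp : measure_display) (T : measurableType disp)
  (P : probability T R).
Context (V : normedModType R) (b : V -> V -> R) (M : R) (bM : form_spec b M)
  (sV : separable V)
  (cV : forall u : nat -> V, cauchy (u n @[n --> \oo]) -> cvg (u n @[n --> \oo])).

Lemma square_integrable_centered (f : T -> V) : square_integrable P f ->
  square_integrable P (fun w => f w - mean P f).
Proof.
move=> Sf; apply: square_integrableB => //; exact: square_integrable_cst.
Qed.

Lemma form_centered (f : T -> V) x : square_integrable P f ->
  \int[P]_w b (f w - mean P f) x = 0.
Proof.
move=> Sf; have If := square_integrable_norm_integrable Sf.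
under eq_Rintegral do rewrite (form_subl bM).
rewrite RintegralB//; [|exact: (form_rintegrable bM)|exact: rintegrable_cst].
rewrite Rintegral_probability_cst -(form_mean bM sV cV x If).
by rewrite subrr.
Qed.

(** The matrix entries of the covariance operator are scalar covariances; this turns statements
    about [Cov] into real integrals. *)
Lemma form_Cov (W : normedModType R) (c : W -> W -> R) (N : R)
    (cN : form_spec c N) (sW : separable W) (f : T -> V) (g : T -> W) y x :
  square_integrable P f -> square_integrable P g ->
  b (Cov P c f g y) x =
  \int[P]_w (c (g w - mean P g) y * b (f w - mean P f) x).
Proof.
move=> Sf Sg; rewrite /Cov (form_mean bM sV cV).
  by apply: eq_Rintegral => w _; rewrite (form_scalel bM).
apply: L2_scale_norm_integrable => //; last exact: square_integrable_centered.
apply: (L2_form cN sW); apply: square_integrableB => //.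
exact: square_integrable_cst.
Qed.

Lemma Cov_linear (W : normedModType R) (c : W -> W -> R) (N : R)
    (cN : form_spec c N) (sW : separable W) (f : T -> V) (g : T -> W) :
  square_integrable P f -> square_integrable P g -> linear (Cov P c f g).
Proof.
move=> Sf Sg a y z; apply: (form_ext bM) => x.
have Lc t : L2 P (fun w => c (g w - mean P g) t).
  apply: (L2_form cN sW); apply: square_integrableB => //.
  exact: square_integrable_cst.
have Lb : L2 P (fun w => b (f w - mean P f) x).
  by apply: (L2_form bM sV); exact: square_integrable_centered.
rewrite (form_addl bM) (form_scalel bM) !(form_Cov cN)//.
rewrite -RintegralZl//; last exact: L2_mul.
rewrite -RintegralD//; [|exact/rintegrableZ/L2_mul|exact: L2_mul].
by apply: eq_Rintegral => w _; rewrite (form_addr cN) (form_scaler cN) mulrDl mulrA.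
Qed.

End Covariance.

(** * Least squares approximation of U by affine functions of Z *)

Section LinearRegression.
Context (R : realType) (X : completeNormedModType R) (ip : X -> X -> R)
  (ipM : form_spec ip 1) (ipn : induces_norm ip) (sX : separable X).
Context (d : nat) (disp : measure_display) (T : measurableType disp)
  (P : probability T R) (U : T -> X) (Z : T -> 'rV[R]_d).
Hypotheses (SU : square_integrable P U) (SZ : square_integrable P Z).

Let U0 w := U w - mean P U.
Let Z0 w := Z w - mean P Z.

Hypothesis nondegenerate :
  forall y, \int[P]_w (dotv (Z0 w) y ^+ 2) = 0 -> y = 0.

Let dotvM := @dotv_form_spec R d.
Let sZ := @separable_rV R d.
Let cX (u : nat -> X) : cauchy (u n @[n --> \oo]) -> cvg (u n @[n --> \oo]) :=
  @cauchy_cvg X (u @ \oo) _.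
Let cZ (u : nat -> 'rV[R]_d) :
    cauchy (u n @[n --> \oo]) -> cvg (u n @[n --> \oo]) :=
  @cauchy_cvg 'rV[R]_d (u @ \oo) _.

(** Injectivity is enough in finite dimension. A [y] killed by the covariance satisfies <Cov(Z) y,
    y> = 0, which is the variance of <Z, y>, and [nondegenerate] applies. *)
Lemma Cov_invertible : exists2 A : 'M[R]_d, A \in unitmx &
  forall y, Cov P (@dotv R d) Z Z y = y *m A.
Proof.
have [A AE] := linear_ex (Cov_linear dotvM sZ cZ dotvM sZ SZ SZ).
exists (lin1_mx A) => [|y]; last by rewrite mul_rV_lin1 AE.
rewrite -row_free_unit; apply/inj_row_free => y.
rewrite mul_rV_lin1 AE => Cy0; apply: nondegenerate.
under eq_Rintegral do rewrite expr2.
by rewrite -(form_Cov dotvM sZ cZ dotvM sZ)// Cy0 (form_0l dotvM).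
Qed.

Lemma Cov_bijective : bijective (Cov P (@dotv R d) Z Z).
Proof.
have [A Au AE] := Cov_invertible; exists (mulmx^~ (invmx A)) => y.
  by rewrite AE mulmxK.
by rewrite AE mulmxKV.
Qed.

(** On a bijection [pinv] is the true inverse, here multiplication by the inverse matrix, so [gain]
    is linear. The second clause is the normal equation, through which [K] enters the regression
    lemmas. *)
Lemma gain_linear : exists2 K : {linear 'rV[R]_d -> X}, K =1 gain P U Z &
  forall y, K (Cov P (@dotv R d) Z Z y) = Cov P (@dotv R d) U Z y.
Proof.
have Cinj : {in [set: 'rV[R]_d] &, injective (Cov P (@dotv R d) Z Z)}.
  by move=> y z _ _; exact: (bij_inj Cov_bijective).
have CK y : pinv [set: 'rV[R]_d] (Cov P (@dotv R d) Z Z)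
    (Cov P (@dotv R d) Z Z y) = y.
  by apply: pinvKV => //; exact: in_setT.
have [A Au AE] := Cov_invertible.
have CE y : pinv [set: 'rV[R]_d] (Cov P (@dotv R d) Z Z) y = y *m invmx A.
  by rewrite -{1}(mulmxKV Au y) -AE CK.
have [B BE] := linear_ex (Cov_linear ipM sX cX dotvM sZ SU SZ).
exists (B \o mulmxr (invmx A)) => [y|y] /=.
  by rewrite BE /gain /= CE.
by rewrite BE AE mulmxK.
Qed.

(** The row vector on the right is the adjoint of [K] applied to [x], for the Euclidean inner
    product. *)
Lemma form_linear_rV (K : {linear 'rV[R]_d -> X}) z x :
  ip (K z) x = dotv z (\row_i ip (K (delta_mx 0 i)) x).
Proof.
rewrite linear_rV_sum (form_suml ipM); apply: eq_bigr => i _.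
by rewrite (form_scalel ipM) mxE.
Qed.

Let SU0 : square_integrable P U0 := square_integrable_centered sX SU.
Let SZ0 : square_integrable P Z0 := square_integrable_centered sZ SZ.

(** * The residual and its orthogonality to affine functions of Z *)

Section Residual.
Context (K : {linear 'rV[R]_d -> X})
  (KE : forall y, K (Cov P (@dotv R d) Z Z y) = Cov P (@dotv R d) U Z y).

Let W w := U0 w - K (Z0 w).

Lemma square_integrable_residual : square_integrable P W.
Proof. by apply: square_integrableB => //; exact: square_integrable_linear. Qed.

Let SW := square_integrable_residual.
Let LW x : L2 P (fun w => ip (W w) x) := L2_form ipM sX x SW.
Let LZ y : L2 P (fun w => dotv (Z0 w) y) := L2_form dotvM sZ y SZ0.

Lemma residual_mean0 x : \int[P]_w ip (W w) x = 0.
Proof.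
under eq_Rintegral do rewrite (form_subl ipM) form_linear_rV.
rewrite RintegralB//; last exact: L2_rintegrable.
  by rewrite (form_centered ipM sX cX)// (form_centered dotvM sZ cZ)// subrr.
by apply: L2_rintegrable; exact: (L2_form ipM sX).
Qed.

(** The integral equals <Cov(U, Z) y, x> - <K Cov(Z) y, x>, which vanishes by the normal equation
    [KE]. *)
Lemma residual_orthogonal y x : \int[P]_w (dotv (Z0 w) y * ip (W w) x) = 0.
Proof.
pose a : 'rV[R]_d := \row_i ip (K (delta_mx 0 i)) x.
under eq_Rintegral do rewrite (form_subl ipM) form_linear_rV -/a mulrBr.
rewrite RintegralB//; last exact: L2_mul.
  rewrite -(form_Cov ipM sX cX dotvM sZ)// -(form_Cov dotvM sZ cZ dotvM sZ)//.
  by rewrite -KE form_linear_rV subrr.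
by apply: L2_mul => //; exact: (L2_form ipM sX).
Qed.

(** Expanding [B (Z0 w)] along the standard basis leaves [residual_mean0] for [v] and finitely many
    instances of [residual_orthogonal]. *)
Lemma residual_orthogonal_affine (v : X) (B : {linear 'rV[R]_d -> X}) :
  \int[P]_w ip (W w) (v + B (Z0 w)) = 0.
Proof.
under eq_Rintegral => w _.
  rewrite (form_addr ipM) linear_rV_sum (form_sym ipM _ (\sum_i _)).
  rewrite (form_suml ipM).
  under eq_bigr => i _.
    rewrite (form_scalel ipM) (form_sym ipM _ (W w)).
    rewrite -dotv_delta; over.
  over.
have Ii i : rintegrable P
    (fun w => dotv (Z0 w) (delta_mx 0 i) * ip (W w) (B (delta_mx 0 i))).
  exact: L2_mul.
rewrite RintegralD//; [|exact: L2_rintegrable|exact: rintegrable_sum].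
rewrite residual_mean0 add0r Rintegral_sum// big1// => i _.
exact: residual_orthogonal.
Qed.

Lemma sqr_residual_affine (v : X) (B : {linear 'rV[R]_d -> X}) :
  \int[P]_w (`|W w + (v + B (Z0 w))| ^+ 2) =
  \int[P]_w (`|W w| ^+ 2) + (`|v| ^+ 2 + \int[P]_w (`|B (Z0 w)| ^+ 2)).
Proof.
have SB := square_integrable_linear B SZ0.
have Sv : square_integrable P (fun _ : T => v) := square_integrable_cst P v.
have SvB := square_integrableD sX Sv SB.
have norm_int f (Sf : square_integrable P f) :
    rintegrable P (fun w => `|f w| ^+ 2).
  by have [_ []] := (square_integrable_L2 P f).1 Sf.
(* The adjoint of [B] at [v]: the cross term between [v] and [B (Z0 w)] becomes <Z0, a>, of mean
   zero because [Z0] is centered. *)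
pose a : 'rV[R]_d := \row_i ip (B (delta_mx 0 i)) v.
have La : rintegrable P (fun w => 2 * dotv (Z0 w) a).
  by apply: rintegrableZ; exact: L2_rintegrable.
have Lc : rintegrable P (fun w => 2 * ip (W w) (v + B (Z0 w))).
  by apply: rintegrableZ; exact: (rintegrable_form ipM sX).
transitivity (\int[P]_w ((`|W w| ^+ 2 + 2 * ip (W w) (v + B (Z0 w))) +
    (`|v| ^+ 2 + (2 * dotv (Z0 w) a + `|B (Z0 w)| ^+ 2)))).
  apply: eq_Rintegral => w _; rewrite -form_linear_rV -!ipn.
  move: (W w) (B (Z0 w)) => p q; rewrite !(form_addl ipM) !(form_addr ipM).
  by rewrite (form_sym ipM v p) (form_sym ipM q p) (form_sym ipM v q); ring.
have [Iv IB IW] := And3 (norm_int _ _ Sv) (norm_int _ _ SB) (norm_int _ _ SW).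
have IaB := rintegrableD La IB.
rewrite RintegralD//; [|exact: rintegrableD|exact: rintegrableD].
rewrite !RintegralD// !(RintegralZl 2)//; last 2 first.
- exact: L2_rintegrable.
- exact: (rintegrable_form ipM sX).
rewrite residual_orthogonal_affine (form_centered dotvM sZ cZ)// !mulr0 addr0 add0r.
by rewrite Rintegral_probability_cst.
Qed.

Lemma analysis_affine w z :
  U w + K (z - Z w) = (mean P U - K (mean P Z) + K z) + W w.
Proof.
(* pairing with [x] turns an identity of vectors into one for [ring] *)
rewrite /W /U0 /Z0 !linearB; apply: (form_ext ipM) => x.
by rewrite !(form_addl ipM, form_oppl ipM); ring.
Qed.

(** The error U - (v + A Z) is W + (E U - A (E Z) - v) + (K - A) Z0, to which [sqr_residual_affine]
    applies. *)
Lemma mse_affine (v : X) (A : {linear 'rV[R]_d -> X}) :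
  mse P U Z (fun z => v + A z) =
  (\int[P]_w (`|W w| ^+ 2) +
   (`|mean P U - A (mean P Z) - v| ^+ 2 +
    \int[P]_w (`|K (Z0 w) - A (Z0 w)| ^+ 2)))%:E.
Proof.
have SAZ : square_integrable P (fun w => U w - (v + A (Z w))).
  apply: square_integrableB => //; apply: square_integrableD => //.
    exact: square_integrable_cst.
  exact: square_integrable_linear.
have [_ [_ IAZ]] := (square_integrable_L2 P _).1 SAZ.
rewrite /mse unlock -(fineK (integrable_fin_num measurableT IAZ)); congr _%:E.
rewrite -(sqr_residual_affine _ (K \- A)); apply: eq_Rintegral => w _ /=.
congr (`|_| ^+ 2); rewrite /W /U0 /Z0 !linearB; apply: (form_ext ipM) => x.
by rewrite !(form_addl ipM, form_oppl ipM); ring.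
Qed.

Section Translation.
Context (v : X).
Let Ua w := v + W w.

Lemma square_integrable_translate : square_integrable P Ua.
Proof. by apply: square_integrableD => //; exact: square_integrable_cst. Qed.

Lemma mean_translate : mean P Ua = v.
Proof.
apply: (form_ext ipM) => x; rewrite (form_mean ipM sX cX); last first.
  exact/square_integrable_norm_integrable/square_integrable_translate.
under eq_Rintegral do rewrite (form_addl ipM).
rewrite RintegralD//; [|exact: rintegrable_cst|exact: L2_rintegrable].
by rewrite residual_mean0 addr0 Rintegral_probability_cst.
Qed.

(** The centered [Ua] is [W]. With [a] the adjoint of [K], <W, x><W, y> = <U0, x><U0, y> - <U0,
    x><Z0, a y> - <Z0, a x><W, y>; the last term has mean zero by orthogonality and the middle one
    gives <K Cov(Z, U) x, y>. *)
Lemma Cov_translate x :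
  Cov P ip Ua Ua x = Cov P ip U U x - K (Cov P ip Z U x).
Proof.
have SUa := square_integrable_translate.
have LU0 t : L2 P (fun w => ip (U0 w) t) := L2_form ipM sX t SU0.
apply: (form_ext ipM) => y; rewrite (form_subl ipM) form_linear_rV.
pose a t : 'rV[R]_d := \row_i ip (K (delta_mx 0 i)) t.
have UaW w : Ua w - mean P Ua = W w.
  by rewrite mean_translate /Ua [v + _]addrC addrK.
have C1 := form_Cov ipM sX cX ipM sX x y SUa SUa.
have C2 := form_Cov ipM sX cX ipM sX x y SU SU.
have C3 := form_Cov dotvM sZ cZ ipM sX x (a y) SZ SU.
apply: (etrans C1); rewrite [X in _ = X - _]C2 [X in _ = _ - X]C3.
have [Ixy Iay Iax] : [/\ rintegrable P (fun w => ip (U0 w) x * ip (U0 w) y),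
    rintegrable P (fun w => ip (U0 w) x * dotv (Z0 w) (a y)) &
    rintegrable P (fun w => dotv (Z0 w) (a x) * ip (W w) y)].
  by split; exact: L2_mul.
have E1 := RintegralB measurableT (rintegrableB Ixy Iay) Iax.
rewrite residual_orthogonal subr0 (RintegralB measurableT Ixy Iay) in E1.
apply: etrans E1; apply: eq_Rintegral => w _; rewrite UaW /W.
by rewrite !(form_subl ipM) !form_linear_rV -/(a x) -/(a y); ring.
Qed.

End Translation.

End Residual.

(** In [mse_affine] both excess terms are nonnegative and vanish for [phi]. For another minimizer
    they must vanish too: the first fixes the intercept, the second the linear part. *)
Lemma is_LCM_unique (K : {linear 'rV[R]_d -> X})
    (KE : forall y, K (Cov P (@dotv R d) Z Z y) = Cov P (@dotv R d) U Z y) :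
  let phi z := (mean P U - K (mean P Z)) + K z in
  is_LCM P U Z phi /\ forall f, is_LCM P U Z f -> f = phi.
Proof.
have norm_bound (A : {linear 'rV[R]_d -> X}) :
    exists M : R, forall z, `|A z| <= M * enorm z.
  have [M M0 AM] := linear_rV_bound A; exists M => z.
  by apply: le_trans (AM z) _; rewrite ler_wpM2l// norm_le_enorm.
have P1phi : P1 (fun z => (mean P U - K (mean P Z)) + K z).
  by exists (mean P U - K (mean P Z)), K; split => //; exact: norm_bound.
have mse_phi : mse P U Z (fun z => (mean P U - K (mean P Z)) + K z) =
    (\int[P]_w (`|U0 w - K (Z0 w)| ^+ 2))%:E.
  rewrite (mse_affine KE) subrr normr0 expr0n add0r.
  under [X in _ + X]eq_Rintegral do rewrite subrr normr0 expr0n.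
  by rewrite Rintegral_probability_cst addr0.
split=> [|f [[v [A [_ fE]]] /(_ _ P1phi)]].
  split=> // f [v [A [_ fE]]]; rewrite mse_phi (_ : f = (fun z => v + A z)).
    rewrite (mse_affine KE) lee_fin lerDl addr_ge0 ?sqr_ge0//.
    by apply: Rintegral_ge0 => w _; exact: sqr_ge0.
  exact/funext.
have {}fE : f = (fun z => v + A z) by exact/funext.
rewrite mse_phi {1}fE (mse_affine KE) lee_fin gerDl => le0.
have int_ge0 : 0 <= \int[P]_w (`|K (Z0 w) - A (Z0 w)| ^+ 2).
  by apply: Rintegral_ge0 => w _; exact: sqr_ge0.
have v0 : mean P U - A (mean P Z) - v = 0.
  apply/eqP; rewrite -normr_eq0 -sqrf_eq0 eq_le sqr_ge0 andbT.
  by apply: le_trans le0; rewrite lerDl.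
have KA0 : \int[P]_w (`|K (Z0 w) - A (Z0 w)| ^+ 2) = 0.
  by apply/eqP; rewrite eq_le int_ge0 andbT; apply: le_trans le0; rewrite lerDr sqr_ge0.
(* With [a] the adjoint of K - A at [x], Cauchy-Schwarz gives E <Z0, a>^2 <= |x|^2 E |(K - A) Z0|^2
   = 0, so [a = 0] by nondegeneracy. *)
have KA : K =1 A.
  move=> z; apply/eqP; rewrite -subr_eq0; apply/eqP; apply: (form_ext ipM) => x.
  rewrite (form_0l ipM); have /= -> := form_linear_rV (K \- A) z x.
  set a := (X in dotv z X); suff -> : a = 0.
    by rewrite (form_sym dotvM) (form_0l dotvM).
  apply: nondegenerate; apply/eqP; rewrite eq_le; apply/andP; split; last first.
    by apply: Rintegral_ge0 => w _; exact: sqr_ge0.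
  have [_ [_ IKA]] := (square_integrable_L2 P _).1
    (square_integrable_linear (K \- A) SZ0).
  rewrite -(mulr0 (`|x| ^+ 2)) -KA0 -RintegralZl//; apply: le_Rintegral => //.
  - by have [] := L2_form dotvM sZ a SZ0.
  - exact: rintegrableZ.
  move=> w _; rewrite -(form_linear_rV (K \- A)) /= -exprMn -real_normK ?num_real//.
  rewrite lerXn2r ?nnegrE ?mulr_ge0// mulrC.
  by apply: le_trans (form_ub ipM _ _) _; rewrite mul1r.
rewrite fE; apply/funext => z; rewrite -!KA; congr (_ + _).
by apply/esym/eqP; rewrite -subr_eq0 KA v0.
Qed.

End LinearRegression.

(** * The observation *)

(** Carries the moment conditions, stated under the laws, over to the probability space. *)
Lemma integral_law (R : realType) (disp disp' : measure_display)
    (T : measurableType disp) (S : measurableType disp') (P : probability T R)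
    (mu : probability S R) (Y : T -> S) (f : S -> \bar R) :
  measurable_fun [set: T] Y -> has_law P Y mu ->
  measurable_fun [set: S] f -> (forall s, 0 <= f s)%E ->
  (\int[mu]_s f s = \int[P]_w f (Y w))%E.
Proof.
move=> mY YP mf f0.
pose m := isMeasurableFun.Build _ _ _ _ Y mY.
pose Y' : {mfun T >-> S} := HB.pack Y m.
rewrite (eq_measure_integral (pushforward P Y')) => [|A mA _]; last exact/esym/YP.
by rewrite ge0_integral_pushforward// preimage_setT.
Qed.

Section Observation.
Context (R : realType) (X : completeNormedModType R) (sX : separable X) (d : nat)
  (disp : measure_display) (Omega : measurableType disp)
  (P : probability Omega R) (U : Omega -> X) (eps : Omega -> 'rV[R]_d)
  (G : X -> 'rV[R]_d)
  (mu0 : probability (borel X) R) (nu : probability (borel 'rV[R]_d) R).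
Hypotheses (U_rv : random_vector U) (eps_rv : random_vector eps)
  (G_cont : continuous G).

Let Z w := G (U w) + eps w.

Lemma measurable_dotv_observation (y : 'rV[R]_d) :
  measurable_fun [set: borel X * borel 'rV[R]_d]
    (fun p : borel X * borel 'rV[R]_d =>
      dotv (G (p.1 : X) + (p.2 : 'rV[R]_d)) y).
Proof.
have m1 : random_vector (fun p : borel X * borel 'rV[R]_d => p.1 : X).
  exact: measurable_fst.
have m2 : random_vector (fun p : borel X * borel 'rV[R]_d => p.2 : 'rV[R]_d).
  exact: measurable_snd.
have sZ := @separable_rV R d.
apply: (measurable_form (dotv_form_spec R d) sZ); last exact: measurable_cst.
apply: random_vectorD => //; exact: (measurable_fun_continuous (h := G)).
Qed.

(** The moments are Euclidean while [square_integrable] uses the sup norm, which is smaller; the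
    single integrand in [U_G_moment] dominates both |U|^2 and |G(U)|^2. *)
Lemma square_integrable_observation
    (U_law : has_law P (U : Omega -> borel X) mu0)
    (eps_law : has_law P (eps : Omega -> borel 'rV[R]_d) nu)
    (U_G_moment :
       (\int[mu0]_u (`|(u : X)| ^+ 2 + enorm (G u) ^+ 2)%:E < +oo)%E)
    (eps_moment : (\int[nu]_e (enorm (e : 'rV[R]_d) ^+ 2)%:E < +oo)%E) :
  square_integrable P U /\ square_integrable P Z.
Proof.
have idX : random_vector (fun u : borel X => u : X) by exact: measurable_id.
have idE : random_vector (fun e : borel 'rV[R]_d => e : 'rV[R]_d).
  exact: measurable_id.
have dM := @dotv_form_spec R d; have sZ := @separable_rV R d.
have mG : random_vector (fun u : borel X => G (u : X)).
  exact: (measurable_fun_continuous (h := G)).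
have mUG : measurable_fun [set: borel X]
    (fun u : borel X => `|(u : X)| ^+ 2 + enorm (G (u : X)) ^+ 2).
  apply: measurable_funD.
    by apply: measurable_funX; exact: measurable_norm_rv.
  under eq_fun => u do rewrite sqr_enorm.
  exact: (measurable_form dM).
have mE : measurable_fun [set: borel 'rV[R]_d]
    (fun e : borel 'rV[R]_d => enorm (e : 'rV[R]_d) ^+ 2).
  under eq_fun do rewrite sqr_enorm.
  exact: (measurable_form dM).
have sq_le (V : normedModType R) (f : Omega -> V) (g : Omega -> R) :
    random_vector f -> measurable_fun [set: Omega] g ->
    (forall w, `|f w| ^+ 2 <= g w) -> (\int[P]_w (g w)%:E < +oo)%E ->
    square_integrable P f.
  move=> mf mg fg Ig; split=> //; apply: le_lt_trans Ig.
  apply: ge0_le_integral => //.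
  - by apply/measurable_EFinP/measurable_funX; exact: measurable_norm_rv.
  - exact/measurable_EFinP.
  - by move=> w _; rewrite lee_fin.
have mUGU : measurable_fun [set: Omega]
    (fun w => `|U w| ^+ 2 + enorm (G (U w)) ^+ 2).
  exact: (measurableT_comp mUG U_rv).
have IUG : (\int[P]_w (`|U w| ^+ 2 + enorm (G (U w)) ^+ 2)%:E < +oo)%E.
  rewrite -(integral_law (mu := mu0) U_rv U_law
    (f := fun u => (`|(u : X)| ^+ 2 + enorm (G u) ^+ 2)%:E))//.
    exact/measurable_EFinP.
  by move=> u; rewrite lee_fin addr_ge0// sqr_ge0.
split; first by apply: sq_le mUGU _ IUG => // w; rewrite lerDl sqr_ge0.
apply: square_integrableD => //.
  apply: sq_le mUGU _ IUG => [|w].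
    exact: (measurable_fun_continuous (h := G)).
  by rewrite sqr_enorm (le_trans (sqr_norm_le_dotv _))// lerDr sqr_ge0.
apply: (@sq_le _ _ (fun w => enorm (eps w) ^+ 2)) => //.
- exact: (measurableT_comp mE eps_rv).
- by move=> w; rewrite sqr_enorm sqr_norm_le_dotv.
rewrite -(integral_law (mu := nu) eps_rv eps_law
  (f := fun e => (enorm (e : 'rV[R]_d) ^+ 2)%:E))//.
  exact/measurable_EFinP.
by move=> e; rewrite lee_fin sqr_ge0.
Qed.

(** Under the product law, the section of the event at [u] is the hyperplane <e, y> = a - <G u, y>,
    which is [nu]-null. *)
Lemma hyperplane_observation0 (y : 'rV[R]_d) (a : R)
    (joint_law : has_law P
       (fun w => (U w, eps w) : borel X * borel 'rV[R]_d) (mu0 \x nu)%E)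
    (nu0 : forall b, nu [set e | dotv (e : 'rV[R]_d) y = b] = 0%E) :
  P [set w | dotv (Z w) y = a] = 0%E.
Proof.
pose S : set (borel X * borel 'rV[R]_d) :=
  [set p | dotv (G (p.1 : X) + (p.2 : 'rV[R]_d)) y = a].
have mS : measurable S.
  by rewrite -[S]setTI; exact: (measurable_dotv_observation y) (measurable_set1 a).
have -> : [set w | dotv (Z w) y = a] =
  (fun w => (U w, eps w) : borel X * borel 'rV[R]_d) @^-1` S by [].
rewrite joint_law// /product_measure1 integral0_eq// => u _ /=.
rewrite -[RHS](nu0 (a - dotv (G u) y)); congr (nu _).
apply/seteqP; split=> [e /set_mem|e eb].
  by rewrite /S /= (form_addl (dotv_form_spec R d)) => <-; rewrite addrC addKr.
apply/mem_set; rewrite /S /= (form_addl (dotv_form_spec R d)) eb.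
by rewrite addrC subrK.
Qed.

(** A vanishing second moment would make <Z - m, y> zero almost surely, so the level set of <Z, y>
    at <m, y> would have probability both 1 and 0. *)
Lemma nondegenerate_observation (m y : 'rV[R]_d) :
  (forall a, P [set w | dotv (Z w) y = a] = 0%E) ->
  \int[P]_w (dotv (Z w - m) y ^+ 2) = 0 -> square_integrable P Z -> False.
Proof.
move=> P0 I0 SZ.
have sZ := @separable_rV R d; have dM := @dotv_form_spec R d.
have [mg Ig] : L2 P (fun w => dotv (Z w - m) y).
  apply: (L2_form dM sZ); apply: square_integrableB => //.
  exact: square_integrable_cst.
pose g2 w := dotv (Z w - m) y ^+ 2.
have := (ae_eq_integral_abs P measurableT (measurable_int _ Ig)).1.
rewrite (eq_integral (EFin \o g2)); last first.
  by move=> w _; rewrite /= ger0_norm// sqr_ge0.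
(* A real integral equal to 0 could hide an infinite one, since [fine] sends infinity to 0;
   integrability rules this out. *)
have -> : (\int[P]_w (EFin \o g2) w = 0)%E.
  rewrite -(fineK (integrable_fin_num measurableT Ig)).
  by rewrite -[X in X%:E]/(Rintegral _ _ _) I0.
move=> /(_ erefl) ae0.
pose D := [set w | dotv (Z w) y = dotv m y].
have mD : measurable D.
  rewrite (_ : D = (fun w => dotv (Z w - m) y) @^-1` [set 0]).
    by rewrite -[X in measurable X]setTI; exact: mg (measurable_set1 _).
  apply/seteqP; split=> w; rewrite /D /= (form_subl dM).
    by move=> ->; rewrite subrr.
  by move=> /eqP; rewrite subr_eq0 => /eqP.
have PD1 : P (~` D) = 0%E.
  apply/negligibleP; first exact: measurableC.
  apply: negligibleS ae0 => w /= Dw; apply: contra_not Dw => /(_ I) /=.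
  by case => /eqP; rewrite sqrf_eq0 /D /= (form_subl dM) subr_eq0 => /eqP.
have := probability_setC P mD; rewrite PD1 P0 sube0 => /eqP.
by rewrite eq_sym onee_eq0.
Qed.
End Observation.

(** The bijectivity and unique existence clauses ensure that [gain] and [LCM], which rest on default
    choices, denote the intended objects; the square integrability clauses do the same for [mean]
    and [Cov]. *)
Theorem theorem13 (R : realType)
  (X : completeNormedModType R) (ip : {dot X for idfun})
  (X_hilbert : induces_norm ip) (X_separable : separable X)
  (d : nat)
  (disp : measure_display) (Omega : measurableType disp)
  (P : probability Omega R)
  (U : Omega -> X) (U_rv : random_vector U)
  (eps : Omega -> 'rV[R]_d) (eps_rv : random_vector eps)
  (G : X -> 'rV[R]_d)
  (mu0 : probability (borel X) R)
  (nu : probability (borel 'rV[R]_d) R)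
  (U_law : has_law P (U : Omega -> borel X) mu0)
  (eps_law : has_law P (eps : Omega -> borel 'rV[R]_d) nu)
  (joint_law : has_law P
     (fun w => (U w, eps w) : borel X * borel 'rV[R]_d) (mu0 \x nu)%E)
  (c : R) (c_gt0 : 0 < c)
  (l : 'rV[R]_d -> R) (l_ge0 : forall x, 0 <= l x)
  (l_meas : measurable_fun setT (l : borel 'rV[R]_d -> R))
  (nu_density : forall A : set (borel 'rV[R]_d), measurable A ->
     nu A = (\int[@lebesgue_rV R d]_(x in A) (c * expR (- l x))%:E)%E)
  (G_cont : continuous G)
  (Phi_cont : let Phi u z := l (z - G u) in
     exists psi : R -> R,
     [/\ forall s, 0 <= s -> 0 <= psi s,
         forall s t, 0 <= s -> s <= t -> psi s <= psi t,
         psi 0 = 0,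
         psi s @[s --> 0^'+] --> (0 : R) &
         forall z1 z2 : 'rV[R]_d,
           (\int[mu0]_u (`|Phi u z1 - Phi u z2| ^+ 2)%:E
              <= (psi (enorm (z1 - z2)))%:E)%E])
  (U_G_moment : (\int[mu0]_u (`|(u : X)| ^+ 2 + enorm (G u) ^+ 2)%:E < +oo)%E)
  (eps_moment : (\int[nu]_e (enorm (e : 'rV[R]_d) ^+ 2)%:E < +oo)%E) :
  let Z w := G (U w) + eps w in
  let K := gain P U Z in
  let phi := LCM P U Z in
  [/\ square_integrable P Z,
      bijective (Cov P (@dotv R d) Z Z),
      exists! f, is_LCM P U Z f &
      forall z : 'rV[R]_d,
        let Ua w := U w + K (z - Z w) in
        [/\ square_integrable P Ua,
            forall w, Ua w = phi z + (U w - phi (Z w)),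
            mean P Ua = phi z &
            forall x : X,
              Cov P ip Ua Ua x =
              Cov P ip U U x - K (Cov P ip Z U x)]].
Proof.
move=> Z K phi.
have ipM := ip_form_spec X_hilbert.
have dM := @dotv_form_spec R d.
have [SU SZ] : square_integrable P U /\ square_integrable P Z.
  exact: (square_integrable_observation U_rv eps_rv G_cont
    U_law eps_law U_G_moment eps_moment).
(* The density turns the measure of a hyperplane into an integral over a set all of whose subsets
   are Lebesgue null. The density formula speaks of measurable sets, hence the measurability
   check. *)
have nu_hyperplane y b : y != 0 -> nu [set e | dotv (e : 'rV[R]_d) y = b] = 0%E.
  move=> y0; rewrite nu_density; last first.
    have idE : random_vector (fun e : borel 'rV[R]_d => e : 'rV[R]_d).
      exact: measurable_id.
    have md : measurable_fun setT
        (fun e : borel 'rV[R]_d => dotv (e : 'rV[R]_d) y).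
      by apply: (measurable_form dM) => //; [exact: separable_rV|exact: measurable_cst].
    rewrite (_ : mkset _ =
      (fun e : borel 'rV[R]_d => dotv (e : 'rV[R]_d) y) @^-1` [set b]) //.
    by rewrite -[X in measurable X]setTI; exact: md (measurable_set1 b).
  by apply: integral_null_set => B; exact: lebesgue_rV_hyperplane.
have nondeg y : \int[P]_w (dotv (Z w - mean P Z) y ^+ 2) = 0 -> y = 0.
  move=> I0; apply: contrapT => /eqP y0.
  apply: (nondegenerate_observation _ I0 SZ) => a.
  apply: (hyperplane_observation0 G_cont a joint_law) => b.
  exact: nu_hyperplane.
have [A AK AE] := gain_linear ipM X_separable SU SZ nondeg.
have [LCMphi phi_unique] := is_LCM_unique ipM X_hilbert X_separable SU SZ nondeg AE.
(* [LCM] picks some minimizer; uniqueness identifies it with the explicit affine map. *)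
have phiE z : phi z = mean P U - A (mean P Z) + A z.
  rewrite /phi /LCM; suff -> : get (is_LCM P U Z) =
    (fun z => mean P U - A (mean P Z) + A z) by [].
  by apply: phi_unique; apply: getPex; eexists; exact: LCMphi.
split=> //; first exact: (Cov_bijective SZ nondeg).
  by exists (fun z => mean P U - A (mean P Z) + A z); split => // f /phi_unique.
move=> z Ua.
have UaE : Ua = (fun w => phi z + ((U w - mean P U) - A (Z w - mean P Z))).
  apply/funext => w; rewrite /Ua /K -AK phiE.
  exact: (analysis_affine ipM P U Z A).
split.
- rewrite UaE; exact: (square_integrable_translate X_separable SU SZ).
- move=> w; rewrite /Ua /K -AK !phiE linearB; apply: (form_ext ipM) => x.
  by rewrite !(form_addl ipM, form_oppl ipM); ring.
- by rewrite UaE (mean_translate ipM X_separable SU SZ A).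
- by move=> x; rewrite UaE /K -AK (Cov_translate ipM X_separable SU SZ AE).
Qed.
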